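(* Let $F=\frac1n\sum_{i=1}^nF_i$. Assume that there is $\widehat\ell>0$ such that for all $x\in\mathbb{R}^d$, with $x^*=\mathrm{proj}_{X^*}(x)$, $$\frac1n\sum_{i=1}^n\|F_i(x)-F_i(x^* )\|^2\le\widehat\ell\,\langle F(x)-F(x^* ),x-x^*\rangle,$$ and that $X^*=\{x^*\}$ is a singleton. Then L-SVRGDA satisfies the key parametric assumption with $A=\widehat\ell$, $B=2$, $\sigma_k^2=\frac1n\sum_{i=1}^n\|F_i(w^k)-F_i(x^* )\|^2$, $C=p\widehat\ell/2$, $\rho=p$, $D_1=D_2=0$.
   Context: Norms and inner products on $\mathbb{R}^d$ are Euclidean. $F,F_1,\dots,F_n:\mathbb{R}^d\to\mathbb{R}^d$ are operators and $R:\mathbb{R}^d\to\mathbb{R}\cup\{+\infty\}$ is a proper lower semicontinuous convex function. $X^*$ is the (nonempty) set of solutions of the regularized variational inequality: find $x^*\in\mathbb{R}^d$ with $\langle F(x^* ),x-x^*\rangle+R(x)-R(x^* )\ge0$ for all $x\in\mathbb{R}^d$. $\mathrm{proj}_{X^*}(x)=\arg\min_{y\in X^*}\|y-x\|$. L-SVRGDA, with $p\in(0,1]$, $\gamma>0$, $w^0=x^0$: at each iteration $k\ge0$ draw $j_k$ uniformly from $\{1,\dots,n\}$ (freshly), set $$g^k=F_{j_k}(x^k)-F_{j_k}(w^k)+F(w^k),$$ $w^{k+1}=x^k$ with probability $p$ and $w^{k+1}=w^k$ with probability $1-p$, and $x^{k+1}=\mathrm{prox}_{\gamma R}(x^k-\gamma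 g^k)$, where $\mathrm{prox}_{\gamma R}(x)=\arg\min_{y}\{R(y)+\|y-x\|^2/(2\gamma)\}$. Put $x^{*,k}=\mathrm{proj}_{X^*}(x^k)$ and $g^{*,k}=F(x^{*,k})$. $\mathbb{E}_k[\cdot]$ is the expectation with respect to the randomness at iteration $k$, i.e. conditional on everything generated before iteration $k$ (in particular on $x^k,w^k$). Key parametric assumption (with constants $A,B,C,D_1,D_2\ge0$, $\rho\in(0,1]$ and nonnegative variables $\sigma_k$): for all $k\ge0$, $\mathbb{E}_k[g^k]=F(x^k)$ and $$\mathbb{E}_k\|g^k-g^{*,k}\|^2\le2A\langle F(x^k)-g^{*,k},x^k-x^{*,k}\rangle+B\sigma_k^2+D_1,$$ $$\mathbb{E}_k[\sigma_{k+1}^2]\le2C\langle F(x^k)-g^{*,k},x^k-x^{*,k}\rangle+(1-\rho)\sigma_k^2+D_2.$$ *)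

(* Defs.v *)
From mathcomp Require Import all_boot all_order all_algebra.
From mathcomp Require Import all_classical all_reals all_analysis.

Set Implicit Arguments.
Unset Strict Implicit.
Unset Printing Implicit Defensive.

Import Order.TTheory GRing.Theory Num.Theory.
Import numFieldNormedType.Exports.

Local Open Scope classical_set_scope.
Local Open Scope ring_scope.

Section Euclidean.
Variables (R : realType) (d : nat).
Implicit Types (x y u v : 'rV[R]_d).

Definition dotp u v : R := \sum_(i < d) u 0 i * v 0 i.

(* The library norm on 'rV[R]_d is the sup norm, hence this definition. *)
Definition enorm u : R := Num.sqrt (dotp u u).

Definition is_argmin (S : set 'rV[R]_d) (f : 'rV[R]_d -> \bar R) y : Prop :=
  S y /\ forall z, S z -> (f y <= f z)%E.

(* A minimizer of f over S; the value 0 is junk, used when there is none. *)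
Definition argmin (S : set 'rV[R]_d) (f : 'rV[R]_d -> \bar R) : 'rV[R]_d :=
  xget 0 [set y | is_argmin S f y].

Definition euclid_proj (S : set 'rV[R]_d) x : 'rV[R]_d :=
  argmin S (fun y => (enorm (y - x))%:E).

Definition prox (gamma : R) (r : 'rV[R]_d -> \bar R) x : 'rV[R]_d :=
  argmin setT (fun y => (r y + (enorm (y - x) ^+ 2 / (2 * gamma))%:E)%E).

Definition proper_function (r : 'rV[R]_d -> \bar R) : Prop :=
  (forall x, r x != -oo%E) /\ exists x, r x != +oo%E.

(* The library's convex_function is for real-valued functions only. *)
Definition econvex_function (r : 'rV[R]_d -> \bar R) : Prop :=
  forall x y (t : R), 0 < t < 1 ->
    (r (t *: x + (1 - t) *: y)%R <= t%:E * r x + (1 - t)%:E * r y)%E.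

(* Since +oo - +oo = -oo in \bar R, a point xs with r xs = +oo is never a
   solution when r is proper. *)
Definition vi_solutions (F : 'rV[R]_d -> 'rV[R]_d) (r : 'rV[R]_d -> \bar R) :
    set 'rV[R]_d :=
  [set xs | forall x, (0 <= (dotp (F xs) (x - xs))%:E + r x - r xs)%E].

End Euclidean.

Section Probability.
Variables (R : realType) (disp : measure_display) (T : measurableType disp).
Variable (P : probability T R).

(* Z is a version of the conditional expectation of Y given the
   sigma-algebra G. *)
Definition is_cond_exp (G : set (set T)) (Y Z : T -> R) : Prop :=
  [/\ P.-integrable setT (EFin \o Y),
      P.-integrable setT (EFin \o Z),
      (forall B : set R, measurable B -> G (Z @^-1` B)) &
      forall A, G A ->
        (\int[P]_(t in A) (Y t)%:E = \int[P]_(t in A) (Z t)%:E)%E].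

(* E[Y | G] <= V almost surely; versions are unique up to null sets, so
   the choice of Z is immaterial. *)
Definition cond_exp_le (G : set (set T)) (Y V : T -> R) : Prop :=
  exists2 Z, is_cond_exp G Y Z & {ae P, forall t, Z t <= V t}.

Definition indep_event (G : set (set T)) (E : set T) : Prop :=
  forall A, G A -> P (A `&` E) = (P A * P E)%E.

End Probability.

Section Algorithm.
Variables (R : realType) (d n : nat).
Variables (disp : measure_display) (T : measurableType disp).
Variable (P : probability T R).

(* At iteration k, j k is the drawn index and c k is the coin deciding whether
   the reference point w is refreshed. *)
Variables (j : nat -> T -> 'I_n) (c : nat -> T -> bool).

(* The sigma-algebra of everything generated before iteration k. *)
Definition past (k : nat) : set (set T) :=
  <<s [set A | exists l, (l < k)%N /\
         ((exists i, A = [set t | j l t = i]) \/ A = [set t | c l t])] >>.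

Definition lsvrgda_draws (p : R) : Prop :=
  forall k,
    (forall i : 'I_n, [/\ measurable [set t | j k t = i],
        P [set t | j k t = i] = (n%:R^-1)%:E &
        indep_event P (past k) [set t | j k t = i]]) /\
    [/\ measurable [set t | c k t],
        P [set t | c k t] = p%:E &
        indep_event P (past k) [set t | c k t]].

Variables (F : 'rV[R]_d -> 'rV[R]_d) (Fi : 'I_n -> 'rV[R]_d -> 'rV[R]_d).
Variables (r : 'rV[R]_d -> \bar R) (gamma : R) (x0 : 'rV[R]_d).

Definition svrg_estimator (i : 'I_n) (x w : 'rV[R]_d) : 'rV[R]_d :=
  Fi i x - Fi i w + F w.

(* The pair (x^k, w^k). *)
Fixpoint lsvrgda (k : nat) (t : T) : 'rV[R]_d * 'rV[R]_d :=
  if k is k'.+1 then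
    let: (x, w) := lsvrgda k' t in
    (prox gamma r (x - gamma *: svrg_estimator (j k' t) x w),
     if c k' t then x else w)
  else (x0, x0).

Definition lsvrgda_x (k : nat) (t : T) : 'rV[R]_d := (lsvrgda k t).1.
Definition lsvrgda_w (k : nat) (t : T) : 'rV[R]_d := (lsvrgda k t).2.
Definition lsvrgda_g (k : nat) (t : T) : 'rV[R]_d :=
  svrg_estimator (j k t) (lsvrgda_x k t) (lsvrgda_w k t).

End Algorithm.

Section KeyAssumption.
Variables (R : realType) (d : nat).
Variables (disp : measure_display) (T : measurableType disp).
Variable (P : probability T R).

(* Here G k is the sigma-algebra defining E_k, and S is the solution set X^*. *)
Definition key_assumption (G : nat -> set (set T))
    (F : 'rV[R]_d -> 'rV[R]_d) (S : set 'rV[R]_d)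
    (x g : nat -> T -> 'rV[R]_d) (sigma : nat -> T -> R)
    (A B C D1 D2 rho : R) : Prop :=
  let xs k t := euclid_proj S (x k t) in
  let gs k t := F (xs k t) in
  let gap k t := dotp (F (x k t) - gs k t) (x k t - xs k t) in
  [/\ [/\ 0 <= A, 0 <= B & 0 <= C],
      [/\ 0 <= D1, 0 <= D2 & 0 < rho <= 1],
      (forall k t, 0 <= sigma k t) &
      forall k,
      [/\ (forall i : 'I_d,
            is_cond_exp P (G k) (fun t => g k t 0 i) (fun t => F (x k t) 0 i)),
          cond_exp_le P (G k)
            (fun t => enorm (g k t - gs k t) ^+ 2)
            (fun t => 2 * A * gap k t + B * sigma k t ^+ 2 + D1) &
          cond_exp_le P (G k)
            (fun t => sigma k.+1 t ^+ 2)
            (fun t => 2 * C * gap k t + (1 - rho) * sigma k t ^+ 2 + D2)]].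

End KeyAssumption.

(* Main.v *)
(* The state (x^k, w^k) takes finitely many values and is a function of the
   earlier draws, so conditioning on the past amounts to averaging over the
   fresh draw with the state held fixed. Write F_i' = F_i - F_i(xstar) and
   F' = F - F(xstar). For the estimator, g^k - F(xstar) is F_j'(x^k) minus the
   centered variable F_j'(w^k) - F'(w^k), whose variance is at most its second
   moment sigma_k^2. For sigma_{k+1}^2, averaging over the coin gives p times
   the mean of |F_i'(x^k)|^2, which cocoercivity bounds, plus
   (1 - p) sigma_k^2. *)
Require Import Defs.
From mathcomp Require Import all_boot all_order all_algebra.
From mathcomp Require Import all_classical all_reals all_analysis.
From mathcomp Require Import lra.
Import Order.TTheory GRing.Theory Num.Theory.
Import numFieldNormedType.Exports.
Local Open Scope classical_set_scope.
Local Open Scope ring_scope.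

Lemma set_eq_false {T : Type} (b : T -> bool) :
  [set t | b t = false] = ~` [set t | b t].
Proof. by apply/seteqP; split=> t /=; case: (b t). Qed.

Lemma probability_finite {R : realType} {disp : measure_display}
    {T : measurableType disp} (P : probability T R) {A : set T} :
  measurable A -> exists a, P A = a%:E.
Proof. by move=> mA; exists (fine (P A)); rewrite fineK ?fin_num_measure. Qed.

(** * Conditional expectations of random variables with finite range *)

Section FiniteRange.
Context {R : realType} {disp : measure_display} {T : measurableType disp}.
Context {P : probability T R}.

Section SimpleExpectation.
Context {V : eqType}.
Variables (Z : T -> V) (S : seq V).
Hypotheses (S_uniq : uniq S) (ZS : forall t, Z t \in S).
Hypothesis Z_meas : forall v, measurable (Z @^-1` [set v]).

(** The fibers of [Z] partition the space, so exactly one term survives. For an arbitrary [f] this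
    makes [f (Z t)] a simple function, and integrals become finite sums. *)
Lemma finite_range_indicE (f : V -> R) t :
  (f (Z t))%:E = (\sum_(v <- S) (f v)%:E * (\1_(Z @^-1` [set v]) t)%:E)%E.
Proof.
rewrite (bigD1_seq (Z t)) //= big1 ?adde0 => [|v /negPf vZ].
  by rewrite indicE mem_set // mule1.
rewrite indicE memNset ?mule0 //= => Zt.
by rewrite Zt eqxx in vZ.
Qed.

Lemma integrable_indic_scale (f : V -> R) v :
  P.-integrable setT (fun t => (f v)%:E * (\1_(Z @^-1` [set v]) t)%:E)%E.
Proof. by apply: integrableZl => //; exact: integrable_indic. Qed.

Lemma integrable_finite_range (f : V -> R) :
  P.-integrable setT (fun t => (f (Z t))%:E).
Proof.
under eq_fun do rewrite finite_range_indicE.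
by apply: integrable_sum => // v _; exact: integrable_indic_scale.
Qed.

Lemma integral_finite_range (f : V -> R) (A : set T) : measurable A ->
  (\int[P]_(t in A) (f (Z t))%:E =
   \sum_(v <- S) (f v)%:E * P (Z @^-1` [set v] `&` A))%E.
Proof.
move=> mA; under eq_integral do rewrite finite_range_indicE.
rewrite integral_sum //= => [|v]; last first.
  exact: integrableS (integrable_indic_scale f v).
apply: eq_bigr => v _; rewrite integralZl ?integral_indic //.
by apply: integrableS (integrable_indic _ _).
Qed.

End SimpleExpectation.

(** On a fiber of [X] the integrand depends on the draw [s] alone, and the fiber meets each [A] of
    [G] in an event of [G], hence independent of [s]. So [X] may be frozen while averaging over
    [s]. *)
Lemma is_cond_exp_indep_draw {U : eqType} {I : finType} {G : set (set T)}
    {X : T -> U} {S : seq U} {s : T -> I} {q : I -> R} :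
  G `<=` measurable -> setI_closed G ->
  (forall B : set U, G (X @^-1` B)) -> (forall t, X t \in S) ->
  (forall i, [/\ measurable [set t | s t = i], P [set t | s t = i] = (q i)%:E &
                 indep_event P G [set t | s t = i]]) ->
  forall f : I -> U -> R,
  is_cond_exp P G (fun t => f (s t) (X t)) (fun t => \sum_i q i * f i (X t)).
Proof.
move=> Gm GI GX XS sq f.
pose S' := undup S.
have XS' t : X t \in S' by rewrite mem_undup.
have XSm v : measurable (X @^-1` [set v]) by apply: Gm.
pose Z t := (s t, X t); pose SZ := [seq (i, v) | i <- index_enum I, v <- S'].
have SZ_uniq : uniq SZ.
  apply: allpairs_uniq; [exact: index_enum_uniq | exact: undup_uniq |].
  by case=> ? ? [? ?] _ _.
have ZS t : Z t \in SZ.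
  by apply: allpairs_f => //; exact: mem_index_enum.
have ZE i v : Z @^-1` [set (i, v)] = X @^-1` [set v] `&` [set t | s t = i].
  by apply/seteqP; split=> t; rewrite /Z /= => -[-> ->].
have Z_meas v : measurable (Z @^-1` [set v]).
  by case: v => i v; rewrite ZE; apply: measurableI; case: (sq i).
pose h (z : I * U) := f z.1 z.2; pose g v := \sum_i q i * f i v.
split.
- exact: (integrable_finite_range Z SZ SZ_uniq ZS Z_meas h).
- exact: (integrable_finite_range X S' (undup_uniq S) XS' XSm g).
- by move=> B _; exact: (GX (g @^-1` B)).
move=> A GA; have mA := Gm _ GA.
rewrite (integral_finite_range Z SZ SZ_uniq ZS Z_meas h A mA).
rewrite (integral_finite_range X S' (undup_uniq S) XS' XSm g A mA).
rewrite big_allpairs exchange_big; apply: eq_bigr => v _.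
have mXA : measurable (X @^-1` [set v] `&` A) by exact: measurableI.
have [m Pm] := probability_finite P mXA.
rewrite Pm -EFinM /g mulr_suml -sumEFin.
apply: eq_bigr => i _; have [_ qi ind] := sq i.
have -> : Z @^-1` [set (i, v)] `&` A =
    (X @^-1` [set v] `&` A) `&` [set t | s t = i] by rewrite ZE setIAC.
rewrite ind ?qi; last by apply: GI.
by rewrite Pm -[LHS]/((h (i, v) * (m * q i))%:E) mulrCA mulrC [h _ * _]mulrC.
Qed.

End FiniteRange.

(** Needed for the coin: [lsvrgda_draws] gives independence for success only, and the failure event
    is its complement. *)
Lemma indep_eventC (R : realType) (disp : measure_display)
    (T : measurableType disp) (P : probability T R) (G : set (set T))
    (E : set T) : G `<=` measurable -> measurable E -> indep_event P G E ->
  indep_event P G (~` E).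
Proof.
move=> Gm mE ind A GA; have mA := Gm _ GA.
transitivity (P A - P (A `&` E))%E.
  by rewrite -setDE; apply: measureD => //; rewrite ltey_eq fin_num_measure.
rewrite ind // probability_setC //.
have [a ->] := probability_finite P mA; have [e ->] := probability_finite P mE.
by rewrite -[LHS]/((a - a * e)%:E) -[RHS]/((a * (1 - e))%:E) mulrBr mulr1.
Qed.

(** * Euclidean norms and the variance bound *)

Section Euclidean.
Context {R : realType} {d : nat}.
Implicit Types u v : 'rV[R]_d.

Lemma enorm_sqr u : enorm u ^+ 2 = \sum_(i < d) u 0 i ^+ 2.
Proof.
rewrite /enorm /dotp; under eq_bigr do rewrite -expr2.
by rewrite sqr_sqrtr // sumr_ge0 // => i _; exact: sqr_ge0.
Qed.

(* Coordinatewise, (a - b)^2 <= 2 a^2 + 2 b^2 with b = v - m, and the variance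
   of the family v is at most its second moment. *)
Lemma mean_sqr_centered_le {n : nat} (a v : 'I_n -> 'rV[R]_d) (m : 'rV[R]_d) :
  (0 < n)%N -> m = n%:R^-1 *: \sum_(i < n) v i ->
  n%:R^-1 * \sum_(i < n) enorm (a i - v i + m) ^+ 2 <=
  2 * (n%:R^-1 * \sum_(i < n) enorm (a i) ^+ 2) +
  2 * (n%:R^-1 * \sum_(i < n) enorm (v i) ^+ 2).
Proof.
move=> n_gt0 mE; have n0 : n%:R != 0 :> R by rewrite pnatr_eq0 -lt0n.
rewrite !mulrA ![2 * n%:R^-1]mulrC -!mulrA -mulrDr ler_wpM2l ?invr_ge0 //.
rewrite !mulr_sumr -big_split /=.
under eq_bigr do rewrite enorm_sqr.
under [leRHS]eq_bigr do rewrite !enorm_sqr !mulr_sumr -big_split /=.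
rewrite exchange_big [leRHS]exchange_big; apply: ler_sum => k _ /=.
have sumv : \sum_(i < n) v i 0 k = n%:R * m 0 k.
  by rewrite mE mxE summxE mulrA divff ?mul1r.
apply: (@le_trans _ _ (\sum_(i < n) (2 * a i 0 k ^+ 2
  + (2 * v i 0 k ^+ 2 - 4 * m 0 k * v i 0 k + 2 * m 0 k ^+ 2)))).
  apply: ler_sum => i _; rewrite !mxE.
  (* With [b = v - m], the right side minus the left is exactly the square of [a + b]. *)
  have := sqr_ge0 (a i 0 k + v i 0 k - m 0 k); nra.
rewrite big_split [leRHS]big_split /= lerD2l.
rewrite 2!big_split /= sumrN -addrA gerDl -mulr_sumr sumv.
rewrite sumr_const card_ord -mulr_natl.
(* The cross terms sum to [-4 n m^2] and the constant terms to [2 n m^2], so [-2 n m^2] remains. *)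
have : 0 <= n%:R * m 0 k ^+ 2 by rewrite mulr_ge0 ?sqr_ge0.
nra.
Qed.

End Euclidean.

(** * The sigma-algebra of the past and the states reachable by the algorithm *)

Section Past.
Context {R : realType} {d n : nat} {disp : measure_display}.
Context {T : measurableType disp}.
Context {j : nat -> T -> 'I_n} {c : nat -> T -> bool}.

Lemma past_setI k : setI_closed (past j c k).
Proof. by move=> A B; exact: (@measurableI _ (g_sigma_algebraType _)). Qed.

Lemma past_set0 k : past j c k set0.
Proof. exact: (@measurable0 _ (g_sigma_algebraType _)). Qed.

Lemma past_setT k : past j c k setT.
Proof. exact: (@measurableT _ (g_sigma_algebraType _)). Qed.

Lemma past_setC k A : past j c k A -> past j c k (~` A).
Proof. exact: (@measurableC _ (g_sigma_algebraType _)). Qed.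

Lemma past_bigcup k (I : finType) (E : I -> set T) :
  (forall i, past j c k (E i)) -> past j c k (\bigcup_i E i).
Proof.
move=> Ek; apply: (@fin_bigcup_measurable _ (g_sigma_algebraType _)) => //.
by move=> i _; exact: Ek.
Qed.

Lemma past_draw l k i : (l < k)%N -> past j c k [set t | j l t = i].
Proof.
by move=> lk; apply: sub_gen_smallest; exists l; split=> //; left; exists i.
Qed.

Lemma past_coin l k b : (l < k)%N -> past j c k [set t | c l t = b].
Proof.
move=> lk; have ck : past j c k [set t | c l t].
  by apply: sub_gen_smallest; exists l; split=> //; right.
case: b => //; rewrite set_eq_false; exact: past_setC.
Qed.

Lemma past_mono k l : (k <= l)%N -> past j c k `<=` past j c l.
Proof.
move=> kl; apply: sub_sigma_algebra2 => A [h [hk hA]].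
by exists h; split=> //; exact: leq_trans kl.
Qed.

Lemma past_measurable (P : probability T R) p :
  lsvrgda_draws P j c p -> forall k, past j c k `<=` measurable.
Proof.
move=> draws k; apply: smallest_sub; first exact: sigma_algebra_measurable.
move=> A [h [_ [[i ->]|->]]]; have [jm [cm _ _]] := draws h => //.
by case: (jm i).
Qed.

Variables (F : 'rV[R]_d -> 'rV[R]_d) (Fi : 'I_n -> 'rV[R]_d -> 'rV[R]_d).
Variables (r : 'rV[R]_d -> \bar R) (gamma : R) (x0 : 'rV[R]_d).
Let X := lsvrgda j c F Fi r gamma x0.

Let step (ib : 'I_n * bool) (z : 'rV[R]_d * 'rV[R]_d) :=
  (prox gamma r (z.1 - gamma *: svrg_estimator F Fi ib.1 z.1 z.2),
   if ib.2 then z.1 else z.2).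

Let lsvrgdaS k t : X k.+1 t = step (j k t, c k t) (X k t).
Proof. by rewrite /X /=; case: (lsvrgda _ _ _ _ _ _ _ k t). Qed.

(** Splitting on the finitely many values of the last draw and coin reduces the event to one about
    the previous state. The induction runs over arbitrary sets [B] because the preimage of [B] under
    [step ib] can be any set, [Fi] being arbitrary maps. *)
Lemma past_lsvrgda k (B : set ('rV[R]_d * 'rV[R]_d)) :
  past j c k (X k @^-1` B).
Proof.
elim: k B => [|k IH] B.
  have [B0|nB0] := pselect (B (x0, x0)).
    have -> : X 0 @^-1` B = setT by apply/seteqP; split.
    exact: past_setT.
  have -> : X 0 @^-1` B = set0 by apply/seteqP; split.
  exact: past_set0.
have -> : X k.+1 @^-1` B = \bigcup_(ib : 'I_n * bool)
    ([set t | j k t = ib.1] `&` [set t | c k t = ib.2] `&`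
     X k @^-1` (step ib @^-1` B)).
  apply/seteqP; split=> t;
    rewrite -[(X k.+1 @^-1` B) t]/(B (X k.+1 t)) lsvrgdaS.
    by move=> Bt; exists (j k t, c k t).
  by move=> [[i b] _ /= [[<- <-]]].
apply: past_bigcup => ib; apply: past_setI.
  by apply: past_setI; [exact: past_draw | exact: past_coin].
exact: past_mono (IH _).
Qed.

(** Each iteration multiplies the number of possible states by at most [2 * n]. *)
Lemma lsvrgda_finite_range k :
  exists S : seq ('rV[R]_d * 'rV[R]_d), forall t, X k t \in S.
Proof.
elim: k => [|k [S XS]]; first by exists [:: (x0, x0)] => t; rewrite mem_head.
exists [seq step ib z | ib <- enum {: 'I_n * bool}, z <- S] => t.
by rewrite lsvrgdaS; apply: allpairs_f; rewrite ?mem_enum.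
Qed.

End Past.

(** The only candidate is a minimizer, so the default value of [argmin] is never taken. *)
Lemma euclid_proj_set1 (R : realType) (d : nat) (y : 'rV[R]_d) :
  euclid_proj [set y] = cst y.
Proof.
apply/funext => x; rewrite /euclid_proj /argmin; case: xgetP => [z _ [] //|].
by move=> /(_ y) []; split=> // z ->.
Qed.

Lemma mean_svrg_estimator {R : realType} {d n : nat}
    (F : 'rV[R]_d -> 'rV[R]_d) (Fi : 'I_n -> 'rV[R]_d -> 'rV[R]_d) :
  (0 < n)%N -> (forall x, F x = n%:R^-1 *: \sum_(i < n) Fi i x) ->
  forall x w, n%:R^-1 *: \sum_(i < n) svrg_estimator F Fi i x w = F x.
Proof.
move=> n_gt0 FE x w; rewrite big_split sumrB sumr_const card_ord /=.
rewrite scalerDr scalerBr -!FE -[F w *+ n]scaler_nat scalerA.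
rewrite mulVf ?scale1r ?subrK //.
by rewrite pnatr_eq0 -lt0n.
Qed.

Theorem proposition4p3 (R : realType) (d n : nat) (n_gt0 : (0 < n)%N)
    (F : 'rV[R]_d -> 'rV[R]_d) (Fi : 'I_n -> 'rV[R]_d -> 'rV[R]_d)
    (r : 'rV[R]_d -> \bar R)
    (r_proper : proper_function r)
    (r_lsc : lower_semicontinuous r)
    (r_convex : econvex_function r)
    (FE : forall x, F x = n%:R^-1 *: \sum_(i < n) Fi i x)
    (l : R) (l_gt0 : 0 < l)
    (F_cocoercive : forall x : 'rV[R]_d,
      let xs := euclid_proj (vi_solutions F r) x in
      n%:R^-1 * \sum_(i < n) enorm (Fi i x - Fi i xs) ^+ 2
        <= l * dotp (F x - F xs) (x - xs))
    (xstar : 'rV[R]_d) (XstarE : vi_solutions F r = [set xstar])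
    (p gamma : R) (p01 : 0 < p <= 1) (gamma_gt0 : 0 < gamma)
    (x0 : 'rV[R]_d)
    (disp : measure_display) (T : measurableType disp) (P : probability T R)
    (j : nat -> T -> 'I_n) (c : nat -> T -> bool)
    (draws : lsvrgda_draws P j c p) :
  key_assumption P (past j c) F (vi_solutions F r)
    (lsvrgda_x j c F Fi r gamma x0)
    (lsvrgda_g j c F Fi r gamma x0)
    (fun k t => Num.sqrt (n%:R^-1 * \sum_(i < n)
       enorm (Fi i (lsvrgda_w j c F Fi r gamma x0 k t) - Fi i xstar) ^+ 2))
    l 2 (p * l / 2) 0 0 p.
Proof.
have /andP[p_gt0 _] := p01.
(* [h] at [w^k] is the square of sigma_k; at [x^k] it is what cocoercivity bounds by the gap. *)
pose h x := n%:R^-1 * \sum_(i < n) enorm (Fi i x - Fi i xstar) ^+ 2.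
have h_ge0 x : 0 <= h x.
  by rewrite mulr_ge0 ?invr_ge0 // sumr_ge0 // => i _; exact: sqr_ge0.
have h_le x : h x <= l * dotp (F x - F xstar) (x - xstar).
  by have := F_cocoercive x; rewrite XstarE euclid_proj_set1.
rewrite XstarE /key_assumption euclid_proj_set1; split.
- by split=> //; [exact: ltW | rewrite divr_ge0 ?mulr_ge0 ?ltW].
- by split.
- by move=> k t; exact: sqrtr_ge0.
move=> k; have Gm := past_measurable P p draws k.
have GX := past_lsvrgda (j := j) (c := c) F Fi r gamma x0 k.
have [S XS] := lsvrgda_finite_range (j := j) (c := c) F Fi r gamma x0 k.
have [jk [cm cp ci]] := draws k.
(* Each estimate involves one fresh draw only, the index for [g^k] and the coin for [w^{k+1}], so
   the two are averaged separately. *)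
have draw := is_cond_exp_indep_draw Gm (past_setI k) GX XS jk.
have coinP b : [/\ measurable [set t | c k t = b],
    P [set t | c k t = b] = (if b then p else 1 - p)%:E &
    indep_event P (past j c k) [set t | c k t = b]].
  case: b => //; rewrite set_eq_false; split; first exact: measurableC.
    by rewrite probability_setC // cp.
  exact: indep_eventC.
have coin := is_cond_exp_indep_draw Gm (past_setI k) GX XS coinP.
have sigma_sqr x : Num.sqrt (h x) ^+ 2 = h x by rewrite sqr_sqrtr.
split.
- move=> a; have := draw (fun i z => svrg_estimator F Fi i z.1 z.2 0 a).
  congr is_cond_exp; apply/funext => t.
  rewrite -(mean_svrg_estimator F Fi n_gt0 FE _
    (lsvrgda_w j c F Fi r gamma x0 k t)).
  by rewrite mxE summxE mulr_sumr.
- eexists; first exact: (draw (fun i z =>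
    enorm (svrg_estimator F Fi i z.1 z.2 - F xstar) ^+ 2)).
  apply: aeW => t; rewrite -mulr_sumr sigma_sqr addr0 -mulrA.
  set z := lsvrgda _ _ _ _ _ _ _ _ _.
  (* Cocoercivity turns [2 * h z.1] into the gap term with [A = l]; [2 * h z.2] is the sigma term
     with [B = 2]. *)
  apply: (@le_trans _ _ (2 * h z.1 + 2 * h z.2)); last first.
    by rewrite lerD2r ler_wpM2l.
  have mE : F z.2 - F xstar = n%:R^-1 *: \sum_(i < n) (Fi i z.2 - Fi i xstar).
    by rewrite sumrB scalerBr -!FE.
  have := mean_sqr_centered_le (fun i => Fi i z.1 - Fi i xstar) _ _ n_gt0 mE.
  congr (_ * _ <= _); apply: eq_bigr => i _; congr (enorm _ ^+ 2).
  (* The two copies of [Fi i xstar] cancel. *)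
  by rewrite /svrg_estimator opprB !addrA subrK.
- exists (fun t => \sum_(b : bool) (if b then p else 1 - p) *
    h (if b then lsvrgda_x j c F Fi r gamma x0 k t
       else lsvrgda_w j c F Fi r gamma x0 k t)).
    have := coin (fun b z => h (if b then z.1 else z.2)).
    congr is_cond_exp; apply/funext => t; rewrite sigma_sqr.
    by rewrite /lsvrgda_w /=; case: (lsvrgda _ _ _ _ _ _ _ k t).
  apply: aeW => t; rewrite big_bool sigma_sqr addr0 lerD2r.
  (* The choice of [C] offsets the factor 2 of the key assumption; the [1 - p] terms already agree,
     leaving [p] times the cocoercivity bound at [x^k]. *)
  have -> : 2 * (p * l / 2) = p * l by lra.
  by rewrite -mulrA ler_wpM2l // ltW.
Qed.
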